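(* Let $W^L$ be a state with specific volume $v^L$, hydrodynamical pressure $p_{\mathrm h}^L$ and total pressure $p^L=p_{\mathrm h}^L+\hat p_{\mathrm b}(v^L)$, connected by a compressive shock to a star state with hydrodynamical pressure $p_{\mathrm h}^*>p_{\mathrm h}^L$, specific volume $v^*<v^L$ solving the Rankine–Hugoniot condition $$\hat e_{\mathrm h}(v^*,p_{\mathrm h}^* )-\hat e_{\mathrm h}(v^L,p_{\mathrm h}^L)+\tfrac12(p_{\mathrm h}^*+p_{\mathrm h}^L)(v^*-v^L)+\hat A_{\mathrm b}(v^*,v^L)=0,$$ and total pressure $p^*=p_{\mathrm h}^*+\hat p_{\mathrm b}(v^* )$. Let $\tilde v^*<v^L$ solve the hydrodynamical condition $\hat e_{\mathrm h}(\tilde v^*,p_{\mathrm h}^* )-\hat e_{\mathrm h}(v^L,p_{\mathrm h}^L)+\tfrac12(p_{\mathrm h}^*+p_{\mathrm h}^L)(\tilde v^*-v^L)=0$. Set $$f^S:=(p^*-p^L)^{1/2}(v^L-v^* )^{1/2},\qquad f^S_{\mathrm h}:=(p_{\mathrm h}^*-p_{\mathrm h}^L)^{1/2}(v^L-\tilde v^* )^{1/2}.$$ Then $$f^S=\Big[1+\frac{\hat p_{\mathrm b}(v^* )-\hat p_{\mathrm b}(v^L)}{p_{\mathrm h}^*-p_{\mathrm h}^L}\Big]^{1/2}\Big[\frac{v^L-v^*}{v^L-\tilde v^*}\Big]^{1/2}f^S_{\mathrm h}\;\ge\;f^S_{\mathrm h}.$$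
   Context: $v=1/\rho$ is the specific volume; a hat marks a quantity expressed as a function of $v$. The total pressure is $p=p_{\mathrm h}+p_{\mathrm b}(\rho)$; $p_{\mathrm h}$ is a complete equation of state with specific internal energy $e_{\mathrm h}$, specific entropy $s_{\mathrm h}$ and sound speed $a_{\mathrm h}$; $p_{\mathrm b}(\rho)=\rho^2\partial_\rho e_{\mathrm b}(\rho)$, i.e. $\hat e_{\mathrm b}'(v)=-\hat p_{\mathrm b}(v)$. $\hat e_{\mathrm h}(v,p_{\mathrm h})$ is $e_{\mathrm h}$ as a function of $v$ and $p_{\mathrm h}$. Standing assumptions (constants $p_\infty,q\in\mathbb R$): $p_{\mathrm h}>-p_\infty$, $a_{\mathrm h}^2=-v^2\partial_v\hat p_{\mathrm h}|_{s_{\mathrm h}}>0$, $\partial_v^2\hat p_{\mathrm h}|_{s_{\mathrm h}}>0$; $\partial_v\hat e_{\mathrm h}|_{p_{\mathrm h}}\ge p_\infty$, $\partial_{p_{\mathrm h}}\hat e_{\mathrm h}|_v\ge0$, $\partial_{s_{\mathrm h}}\hat p_{\mathrm h}|_v>0$, $\hat e_{\mathrm h}\ge q$, $\lim_{v\to0+}\hat e_{\mathrm h}(v,p_{\mathrm h})=q$; $e_{\mathrm b}$ is $C^3$ and $a_{\mathrm b}^2(\rho)=\partial_\rho p_{\mathrm b}(\rho)\ge0$ (so $\hat p_{\mathrm b}$ is non-increasing in $v$). Moreover $\hat A_{\mathrm b}(v^*,v):=\hat e_{\mathrm b}(v^* )-\hat e_{\mathrm b}(v)+\tfrac12(\hat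 p_{\mathrm b}(v^* )+\hat p_{\mathrm b}(v))(v^*-v)$. *)

(* Defs.v *)
From Stdlib Require Export Reals.
From Coquelicot Require Export Coquelicot.
Open Scope R_scope.

(* Complete equation of state of the hydrodynamical part.  [e_vs], [p_vs] and
   [T_vs] are functions of the specific volume v and the specific entropy s,
   meaningful on the open set [dom]; [s_vp] expresses the entropy as a function
   of v and the pressure.  The pairs (volume, pressure) of the admissible
   states are exactly those with v > 0 and pressure > - p_inf. *)
Record complete_eos (p_inf : R) : Type := CompleteEos {
  dom : R -> R -> Prop;
  e_vs : R -> R -> R;
  p_vs : R -> R -> R;
  T_vs : R -> R -> R;
  s_vp : R -> R -> R;
  dom_open : open (fun x : R * R => dom (fst x) (snd x));
  dom_volume_pos : forall v s, dom v s -> 0 < v;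
  dom_pressure : forall v s, dom v s -> - p_inf < p_vs v s;
  (* Gibbs relation: de = - p dv + T ds *)
  gibbs : forall v s, dom v s ->
    differentiable_pt_lim e_vs v s (- p_vs v s) (T_vs v s);
  s_vp_dom : forall v p, 0 < v -> - p_inf < p -> dom v (s_vp v p);
  p_vs_s_vp : forall v p, 0 < v -> - p_inf < p -> p_vs v (s_vp v p) = p;
  s_vp_p_vs : forall v s, dom v s -> s_vp v (p_vs v s) = s
}.

Arguments dom {p_inf}.
Arguments e_vs {p_inf}.
Arguments p_vs {p_inf}.
Arguments T_vs {p_inf}.
Arguments s_vp {p_inf}.

Definition sound_speed_sq {p_inf : R} (E : complete_eos p_inf) (v s : R) : R :=
  - v ^ 2 * Derive (fun w => p_vs E w s) v.

Definition e_vp {p_inf : R} (E : complete_eos p_inf) (v p : R) : R :=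
  e_vs E v (s_vp E v p).

(* [Derive] is a total function, hence the explicit differentiability fields. *)
Record hydro_assumptions {p_inf : R} (q : R) (E : complete_eos p_inf) : Prop := {
  p_vs_diff_v : forall v s, dom E v s -> ex_derive (fun w => p_vs E w s) v;
  p_vs_diff_v2 : forall v s, dom E v s -> ex_derive_n (fun w => p_vs E w s) 2 v;
  p_vs_diff_s : forall v s, dom E v s -> ex_derive (fun t => p_vs E v t) s;
  sound_speed_pos : forall v s, dom E v s -> 0 < sound_speed_sq E v s;
  p_vs_convex : forall v s, dom E v s -> 0 < Derive_n (fun w => p_vs E w s) 2 v;
  p_vs_incr_s : forall v s, dom E v s -> 0 < Derive (fun t => p_vs E v t) s;
  e_vp_diff_v : forall v p, 0 < v -> - p_inf < p ->
    ex_derive (fun w => e_vp E w p) v;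
  e_vp_diff_p : forall v p, 0 < v -> - p_inf < p ->
    ex_derive (fun r => e_vp E v r) p;
  e_vp_dv : forall v p, 0 < v -> - p_inf < p ->
    p_inf <= Derive (fun w => e_vp E w p) v;
  e_vp_dp : forall v p, 0 < v -> - p_inf < p ->
    0 <= Derive (fun r => e_vp E v r) p;
  e_vp_lower : forall v p, 0 < v -> - p_inf < p -> q <= e_vp E v p;
  e_vp_lim0 : forall p, - p_inf < p ->
    filterlim (fun v => e_vp E v p) (at_right 0) (locally q)
}.

(* Barotropic part: the energy [eb] is a function of the density rho. *)
Definition p_baro (eb : R -> R) (rho : R) : R := rho ^ 2 * Derive eb rho.

Definition eb_hat (eb : R -> R) (v : R) : R := eb (/ v).
Definition pb_hat (eb : R -> R) (v : R) : R := p_baro eb (/ v).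

Record baro_assumptions (eb : R -> R) : Prop := {
  eb_C3_ex : forall (k : nat) rho, (k <= 3)%nat -> 0 < rho -> ex_derive_n eb k rho;
  eb_C3_cont : forall rho, 0 < rho -> continuous (Derive_n eb 3) rho;
  ab_sq_nonneg : forall rho, 0 < rho -> 0 <= Derive (p_baro eb) rho
}.

Definition Ab_hat (eb : R -> R) (vstar v : R) : R :=
  eb_hat eb vstar - eb_hat eb v
  + / 2 * (pb_hat eb vstar + pb_hat eb v) * (vstar - v).

Definition total_pressure (eb : R -> R) (v ph : R) : R := ph + pb_hat eb v.

(* Left-hand side of the purely hydrodynamical Rankine-Hugoniot condition,
   from (vL, phL) to (v, ph). *)
Definition hydro_hugoniot {p_inf : R} (E : complete_eos p_inf)
    (v ph vL phL : R) : R :=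
  e_vp E v ph - e_vp E vL phL + / 2 * (ph + phL) * (v - vL).

(* Main.v *)
(* Write [dph = ph* - phL] and [dpb = pb(v* ) - pb(vL)], so that [dpb >= 0].  The
   inequality is [dph (vL - vt) <= (dph + dpb) (vL - v* )], and only the case
   [vt < v*] is not immediate.  The barotropic defect [Ab] has no sign in general,
   but since [pb] decreases, [- Ab(v*, vL) <= dpb (vL - v* ) / 2].  Moreover the
   hydrodynamical Hugoniot function has v-derivative at least
   [p_inf + (ph* + phL) / 2 >= dph / 2].  Comparing its values at [vt] and [v*]
   gives [dph (v* - vt) <= dpb (vL - v* )], which is the claim. *)

From Stdlib Require Import Lra Lia.
Require Import Defs.

(** One-sided mean value theorem, applied below to [p_baro eb], [- eb_hat eb] and [e_vp E] at fixed
    pressure. *)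
Lemma derive_lower_bound_increment (f df : R -> R) (m a b : R) :
  a <= b ->
  (forall x, a <= x <= b -> is_derive f x (df x)) ->
  (forall x, a <= x <= b -> m <= df x) ->
  m * (b - a) <= f b - f a.
Proof.
  intros Hab Hd Hm.
  destruct (MVT_gen f a b df) as [c [Hc Heq]];
    rewrite ?(Rmin_left a b), ?(Rmax_right a b) in * by exact Hab.
  - intros x Hx; apply Hd; lra.
  - intros x Hx; apply derivable_continuous_pt.
    exists (df x); apply is_derive_Reals, Hd; lra.
  - rewrite Heq; apply Rmult_le_compat_r; [lra | exact (Hm c Hc)].
Qed.

Lemma p_baro_ex_derive (eb : R -> R) (rho : R) :
  baro_assumptions eb -> 0 < rho -> ex_derive (p_baro eb) rho.
Proof.
  intros heb Hrho; unfold p_baro.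
  apply @ex_derive_mult.
  - now auto_derive.
  (* By conversion, [ex_derive_n eb 2] is differentiability of [Derive eb]. *)
  - exact (eb_C3_ex eb heb 2 rho ltac:(lia) Hrho).
Qed.

Lemma pb_hat_nonincreasing (eb : R -> R) (v w : R) :
  baro_assumptions eb -> 0 < v -> v <= w -> pb_hat eb w <= pb_hat eb v.
Proof.
  intros heb Hv Hvw; unfold pb_hat.
  assert (Hw : 0 < / w) by (apply Rinv_0_lt_compat; lra).
  assert (Hinv : / w <= / v) by (apply Rinv_le_contravar; assumption).
  pose proof (derive_lower_bound_increment (p_baro eb) (Derive (p_baro eb)) 0
                (/ w) (/ v) Hinv) as H.
  assert (0 * (/ v - / w) <= p_baro eb (/ v) - p_baro eb (/ w)); [apply H | lra].
  - intros x Hx; apply Derive_correct, p_baro_ex_derive; [exact heb | lra].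
  - intros x Hx; apply (ab_sq_nonneg eb heb); lra.
Qed.

(** Chain rule: the inner derivative [- / v ^ 2] supplies exactly the factor [rho ^ 2] of [p_baro],
    with a minus sign. *)
Lemma eb_hat_is_derive (eb : R -> R) (v : R) :
  baro_assumptions eb -> 0 < v -> is_derive (eb_hat eb) v (- pb_hat eb v).
Proof.
  intros heb Hv; unfold eb_hat, pb_hat, p_baro.
  assert (Hex : ex_derive eb (/ v)).
  { apply (eb_C3_ex eb heb 1); [lia | now apply Rinv_0_lt_compat]. }
  auto_derive; [repeat split; [exact Hex | lra] |].
  change (Derive (fun x => eb x) (/ v)) with (Derive eb (/ v)).
  field; lra.
Qed.

(** On [[v, w]] the derivative [pb_hat eb] of [- eb_hat eb] is at least its value at [w]; the
    trapezoidal term of [Ab_hat] then leaves half the pressure jump. *)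
Lemma Ab_hat_lower_bound (eb : R -> R) (v w : R) :
  baro_assumptions eb -> 0 < v -> v <= w ->
  - / 2 * (pb_hat eb v - pb_hat eb w) * (w - v) <= Ab_hat eb v w.
Proof.
  intros heb Hv Hvw.
  assert (H : pb_hat eb w * (w - v) <= - eb_hat eb w - - eb_hat eb v).
  { apply (derive_lower_bound_increment (fun x => - eb_hat eb x) (pb_hat eb));
      [exact Hvw | |].
    - intros x Hx; rewrite <- (Ropp_involutive (pb_hat eb x)).
      apply @is_derive_opp, eb_hat_is_derive; [exact heb | lra].
    - intros x Hx; apply pb_hat_nonincreasing; [exact heb | lra | lra]. }
  unfold Ab_hat; lra.
Qed.

(** The energy has slope at least [p_inf] in the volume, and the remaining term is affine with slope
    [/ 2 * (ph + phL)]. *)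
Lemma hydro_hugoniot_increment (p_inf q : R) (E : complete_eos p_inf)
  (v w ph vL phL : R) :
  hydro_assumptions q E -> 0 < v -> v <= w -> - p_inf < ph ->
  (p_inf + / 2 * (ph + phL)) * (w - v)
  <= hydro_hugoniot E w ph vL phL - hydro_hugoniot E v ph vL phL.
Proof.
  intros hE Hv Hvw Hp.
  assert (H : p_inf * (w - v) <= e_vp E w ph - e_vp E v ph).
  { apply (derive_lower_bound_increment (fun x => e_vp E x ph)
             (Derive (fun x => e_vp E x ph))); [exact Hvw | |].
    - intros x Hx; apply Derive_correct, (e_vp_diff_v q E hE); [lra | exact Hp].
    - intros x Hx; apply (e_vp_dv q E hE); [lra | exact Hp]. }
  unfold hydro_hugoniot; lra.
Qed.

Theorem proposition3p12 (p_inf q : R) (E : complete_eos p_inf) (eb : R -> R)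
  (hE : hydro_assumptions q E) (heb : baro_assumptions eb)
  (vL phL pL vstar phstar pstar vtilde fS fSh : R)
  (hvL : 0 < vL) (hphL : - p_inf < phL)
  (hpL : pL = total_pressure eb vL phL)
  (hph : phL < phstar)
  (hvstar : 0 < vstar) (hvstarL : vstar < vL)
  (hRH : hydro_hugoniot E vstar phstar vL phL + Ab_hat eb vstar vL = 0)
  (hpstar : pstar = total_pressure eb vstar phstar)
  (hvtilde : 0 < vtilde) (hvtildeL : vtilde < vL)
  (hRHh : hydro_hugoniot E vtilde phstar vL phL = 0)
  (hfS : fS = sqrt (pstar - pL) * sqrt (vL - vstar))
  (hfSh : fSh = sqrt (phstar - phL) * sqrt (vL - vtilde)) :
  fS = sqrt (1 + (pb_hat eb vstar - pb_hat eb vL) / (phstar - phL))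
       * sqrt ((vL - vstar) / (vL - vtilde)) * fSh
  /\ fS >= fSh.
Proof.
  pose proof (pb_hat_nonincreasing eb vstar vL heb hvstar ltac:(lra)) as Hpb.
  pose proof (Ab_hat_lower_bound eb vstar vL heb hvstar ltac:(lra)) as HA.
  assert (Hjump : pstar - pL
                  = phstar - phL + (pb_hat eb vstar - pb_hat eb vL)).
  { subst; unfold total_pressure; ring. }
  rewrite Hjump in hfS.
  set (dpb := pb_hat eb vstar - pb_hat eb vL) in *.
  assert (Hdpb : 0 <= dpb) by (unfold dpb; lra).
  assert (Hratio : 0 <= dpb / (phstar - phL)).
  { apply Rdiv_le_0_compat; lra. }
  assert (Hvratio : 0 <= (vL - vstar) / (vL - vtilde)).
  { apply Rdiv_le_0_compat; lra. }
  split.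
  - rewrite hfS, hfSh.
    (* Four merges leave a single root on each side: one on the left, three on the right. *)
    do 4 (rewrite <- sqrt_mult by (first [lra | apply Rmult_le_pos; lra])).
    apply (f_equal sqrt); field; lra.
  - apply Rle_ge; rewrite hfS, hfSh.
    rewrite <- !sqrt_mult by lra.
    apply sqrt_le_1_alt.
    destruct (Rle_or_lt vstar vtilde) as [Hle | Hlt].
    + apply Rmult_le_compat; lra.
    + pose proof (hydro_hugoniot_increment p_inf q E vtilde vstar phstar vL phL
                    hE hvtilde ltac:(lra) ltac:(lra)) as HH.
      (* The two slopes differ by [p_inf + phL], which is positive by [hphL]. *)
      assert (Hslope : / 2 * (phstar - phL) * (vstar - vtilde)
                <= (p_inf + / 2 * (phstar + phL)) * (vstar - vtilde)).
      { apply Rmult_le_compat_r; lra. }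
      (* By [hRH] and [hRHh] the increment in [HH] equals [- Ab_hat eb vstar vL], which [HA] bounds
         by [/ 2 * dpb * (vL - vstar)]. *)
      lra.
Qed.
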